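(* Let $\Omega\subset\mathbb{R}^N$ ($N\ge2$) be a smooth bounded domain, $L$ a uniformly elliptic second-order operator $Lu=-\sum_{i,j=1}^N a_{ij}(x)\frac{\partial^2u}{\partial x_i\partial x_j}+c(x)\cdot\nabla u$ with smooth coefficients on $\overline\Omega$ and $a_{ij}=a_{ji}$, $f:[0,a_f)\to\mathbb{R}_+$ a regular or singular nonlinearity, and $\lambda>0$. Let $u\in C^2(\Omega)$ be a solution of $$Lu=\lambda f(u)\ \text{ in }\Omega,\qquad u=0\ \text{ on }\partial\Omega.$$ Then $$F^{-1}\big(\lambda\psi_L(x)\big)\le u(x)\quad\text{for all }x\in\Omega.$$ Therefore, if $x_0\in\Omega$ is such that $\psi_L(x_0)=\psi_{L,\Omega}$, then $$\lambda\le\frac{F(u(x_0))}{\psi_{L,\Omega}}.$$ In particular, the extremal parameter $\lambda^*$ and the extremal solution $u^*$ satisfy $$\lambda^*\le\frac{F(u^*(x_0))}{\psi_{L,\Omega}}\le\frac{F(a_f)}{\psi_{L,\Omega}}\quad\text{and}\quad F^{-1}\big(\lambda^*\psi_L(x)\big)\le u^*(x)\ \text{ for all }x\in\Omega.$$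
   Context: Nonlinearities: $f:[0,a_f)\to\mathbb{R}_+$ is smooth, increasing and convex, with $f(0)>0$ and $\int_0^{a_f}\frac{ds}{f(s)}<\infty$. It is regular if $a_f=+\infty$ and $f(t)/t\to\infty$ as $t\to\infty$, and singular if $a_f=1$ and $\lim_{t\nearrow1}f(t)=+\infty$. $F:[0,a_f]\to\mathbb{R}_+$ is $F(t)=\int_0^t\frac{ds}{f(s)}$. The torsion function $\psi_L$ is the unique nonnegative smooth solution of $L\psi_L=1$ in $\Omega$, $\psi_L=0$ on $\partial\Omega$; $\psi_{L,\Omega}=\sup_\Omega\psi_L$. A solution $u$ is classical if $\|u\|_{L^\infty}<\infty$ (regular $f$) or $\|u\|_{L^\infty}<1$ (singular $f$). The extremal parameter $\lambda^*\in(0,\infty)$ is the number such that the problem has a minimal classical solution $u_\lambda$ (the smallest nonnegative solution) for $0<\lambda<\lambda^*$ and no classical solution for $\lambda>\lambda^*$. For each $x$, $u_\lambda(x)$ increases in $\lambda$, and the extremal solution is $u^*(x)=\lim_{\lambda\nearrow\lambda^*}u_\lambda(x)$ (values in $[0,a_f]$). *)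

(* Defs.v *)
From HB Require Import structures.
From mathcomp Require Import all_boot all_order all_algebra.
From mathcomp Require Import all_classical all_reals all_analysis.

Set Implicit Arguments.
Unset Strict Implicit.
Unset Printing Implicit Defensive.

Import Order.TTheory GRing.Theory Num.Theory.
Import numFieldNormedType.Exports.

Local Open Scope classical_set_scope.
Local Open Scope ring_scope.

(* [Ck_on k U g]: all iterated directional derivatives of [g] of order at most
   [k] exist and are continuous on the open set [U]. In finite dimension this
   is the usual class C^k, defined with partial derivatives. *)
Fixpoint Ck_on (R : realType) (V : normedModType R) (k : nat) (U : set V)
    (g : V -> R) : Prop :=
  (forall x, U x -> {for x, continuous g}) /\
  (if k is k'.+1 then
     forall v : V, (forall x, U x -> derivable g x v) /\ Ck_on k' U ('D_v g)
   else True).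

Definition smooth_on (R : realType) (V : normedModType R) (U : set V)
    (g : V -> R) : Prop :=
  forall k, Ck_on k U g.

(* Smoothness on a set that need not be open (such as a closed domain or
   [0, a)): there is a smooth extension to an open neighbourhood. *)
Definition smooth_upto (R : realType) (V : normedModType R) (A : set V)
    (g : V -> R) : Prop :=
  exists (U : set V) (h : V -> R),
    [/\ open U, A `<=` U, smooth_on U h & forall x, A x -> h x = g x].

Definition partial (R : realType) (N : nat) (i : 'I_N) (g : 'rV[R]_N -> R) :
    'rV[R]_N -> R :=
  'D_(delta_mx 0 i) g.

(* The topological boundary of an open set. *)
Definition bdry (R : realType) (N : nat) (Omega : set 'rV[R]_N) :
    set 'rV[R]_N :=
  closure Omega `\` Omega.

(* The boundary is smooth in the sense of local defining functions: near each
   of its points, Omega is a sublevel set of a smooth function with nonzero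
   gradient; thus Omega lies locally on one side of a smooth hypersurface. *)
Record smooth_bounded_domain (R : realType) (N : nat)
    (Omega : set 'rV[R]_N) : Prop := SmoothBoundedDomain {
  domain_open : open Omega ;
  domain_nonempty : Omega !=set0 ;
  domain_connected : connected Omega ;
  domain_bounded : bounded_set Omega ;
  domain_smooth : forall x0, bdry Omega x0 ->
    exists (U : set 'rV[R]_N) (phi : 'rV[R]_N -> R),
      [/\ open U, U x0, smooth_on U phi,
          exists i, partial i phi x0 != 0 &
          Omega `&` U = [set x | U x /\ phi x < 0]]
}.

Definition elliptic_op (R : realType) (N : nat) (a : 'rV[R]_N -> 'M[R]_N)
    (c : 'rV[R]_N -> 'rV[R]_N) (u : 'rV[R]_N -> R) (x : 'rV[R]_N) : R :=
  - (\sum_(i < N) \sum_(j < N) a x i j * partial i (partial j u) x)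
  + \sum_(i < N) c x 0 i * partial i u x.

Record uniformly_elliptic (R : realType) (N : nat) (Omega : set 'rV[R]_N)
    (a : 'rV[R]_N -> 'M[R]_N) (c : 'rV[R]_N -> 'rV[R]_N) : Prop :=
  UniformlyElliptic {
  coef_a_smooth :
    forall i j, smooth_upto (closure Omega) (fun x => a x i j) ;
  coef_c_smooth : forall i, smooth_upto (closure Omega) (fun x => c x 0 i) ;
  coef_a_sym : forall x, Omega x -> forall i j, a x i j = a x j i ;
  ellipticity : exists2 theta : R, 0 < theta &
    forall x, Omega x -> forall xi : 'rV[R]_N,
      theta * \sum_(i < N) xi 0 i ^+ 2 <=
      \sum_(i < N) \sum_(j < N) a x i j * xi 0 i * xi 0 j
}.

(* [0, t), with t possibly infinite *)
Definition halfopen (R : realType) (t : \bar R) : set R :=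
  [set s : R | (0 <= s%:E < t)%E].

Record nonlinearity (R : realType) (af : \bar R) (f : R -> R) : Prop :=
  Nonlinearity {
  nl_smooth : smooth_upto (halfopen af) f ;
  nl_nonneg : forall t, halfopen af t -> 0 <= f t ;
  nl_incr : forall s t, halfopen af s -> halfopen af t -> s <= t -> f s <= f t ;
  nl_convex : @convex_function R R^o (halfopen af) f ;
  nl_pos0 : 0 < f 0 ;
  nl_integral :
    (\int[@lebesgue_measure R]_(s in halfopen af) ((f s)^-1)%:E < +oo)%E
}.

Definition regular_nonlinearity (R : realType) (af : \bar R) (f : R -> R) :
    Prop :=
  [/\ nonlinearity af f, af = +oo%E & f t / t @[t --> +oo] --> +oo].

Definition singular_nonlinearity (R : realType) (af : \bar R) (f : R -> R) :
    Prop :=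
  [/\ nonlinearity af f, af = 1%:E & f t @[t --> 1^'-] --> +oo].

Definition Fdom (R : realType) (af : \bar R) : set (\bar R) :=
  [set t | (0 <= t <= af)%E].

(* F is meant on [Fdom af]; its argument is an extended real so that F(af)
   makes sense when af = +oo. *)
Definition Fint (R : realType) (f : R -> R) (t : \bar R) : R :=
  \int[@lebesgue_measure R]_(s in halfopen t) (f s)^-1.

(* The inverse of F : Fdom af -> R; only meaningful on F @` Fdom af. *)
Definition Finv (R : realType) (af : \bar R) (f : R -> R) : R -> \bar R :=
  pinv_ (fun=> 0%E) (Fdom af) (Fint f).

Record torsion_function (R : realType) (N : nat) (Omega : set 'rV[R]_N)
    (a : 'rV[R]_N -> 'M[R]_N) (c : 'rV[R]_N -> 'rV[R]_N)
    (psi : 'rV[R]_N -> R) : Prop := TorsionFunction {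
  torsion_smooth : smooth_on Omega psi ;
  torsion_cont : {within closure Omega, continuous psi} ;
  torsion_nonneg : forall x, Omega x -> 0 <= psi x ;
  torsion_eq : forall x, Omega x -> elliptic_op a c psi x = 1 ;
  torsion_bdry : forall x, bdry Omega x -> psi x = 0
}.

(* [sol_range] makes f(u) meaningful, the domain of f being [0, af);
   [sol_cont] makes the pointwise boundary condition meaningful. *)
Record solution (R : realType) (N : nat) (Omega : set 'rV[R]_N)
    (a : 'rV[R]_N -> 'M[R]_N) (c : 'rV[R]_N -> 'rV[R]_N)
    (af : \bar R) (f : R -> R) (lambda : R) (u : 'rV[R]_N -> R) : Prop :=
  Solution {
  sol_C2 : Ck_on 2 Omega u ;
  sol_cont : {within closure Omega, continuous u} ;
  sol_range : forall x, Omega x -> halfopen af (u x) ;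
  sol_eq : forall x, Omega x -> elliptic_op a c u x = lambda * f (u x) ;
  sol_bdry : forall x, bdry Omega x -> u x = 0
}.

(* As af is +oo or 1, the bound on the sup norm is the one that defines
   classical solutions in the regular, resp. singular, case. *)
Definition classical_solution (R : realType) (N : nat) (Omega : set 'rV[R]_N)
    (a : 'rV[R]_N -> 'M[R]_N) (c : 'rV[R]_N -> 'rV[R]_N)
    (af : \bar R) (f : R -> R) (lambda : R) (u : 'rV[R]_N -> R) : Prop :=
  solution Omega a c af f lambda u /\
  (ereal_sup [set `|u x|%:E | x in Omega] < af)%E.

Definition minimal_solution (R : realType) (N : nat) (Omega : set 'rV[R]_N)
    (a : 'rV[R]_N -> 'M[R]_N) (c : 'rV[R]_N -> 'rV[R]_N)
    (af : \bar R) (f : R -> R) (lambda : R) (u : 'rV[R]_N -> R) : Prop :=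
  classical_solution Omega a c af f lambda u /\
  (forall v, solution Omega a c af f lambda v ->
     forall x, Omega x -> u x <= v x).

Definition extremal_parameter (R : realType) (N : nat) (Omega : set 'rV[R]_N)
    (a : 'rV[R]_N -> 'M[R]_N) (c : 'rV[R]_N -> 'rV[R]_N)
    (af : \bar R) (f : R -> R) (lstar : R) : Prop :=
  [/\ 0 < lstar,
      forall lambda, 0 < lambda < lstar ->
        exists u, minimal_solution Omega a c af f lambda u &
      forall lambda, lstar < lambda ->
        ~ exists u, classical_solution Omega a c af f lambda u].

(* The minimal solutions are determined on Omega by lambda, so the choice of
   the family [v] is immaterial. *)
Definition extremal_solution (R : realType) (N : nat) (Omega : set 'rV[R]_N)
    (a : 'rV[R]_N -> 'M[R]_N) (c : 'rV[R]_N -> 'rV[R]_N)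
    (af : \bar R) (f : R -> R) (lstar : R) (ustar : 'rV[R]_N -> \bar R) : Prop :=
  exists v : R -> 'rV[R]_N -> R,
    (forall lambda, 0 < lambda < lstar ->
       minimal_solution Omega a c af f lambda (v lambda)) /\
    (forall x, Omega x ->
       (v lambda x)%:E @[lambda --> lstar^'-] --> ustar x).

(* Main.v *)
Require Import Defs.
From HB Require Import structures.
From mathcomp Require Import all_boot all_order all_algebra.
From mathcomp Require Import all_classical all_reals all_analysis.
From mathcomp Require Import measurable_realfun.
From mathcomp Require Import ring lra.

Set Implicit Arguments.
Unset Strict Implicit.
Unset Printing Implicit Defensive.

Import Order.TTheory GRing.Theory Num.Theory.
Import numFieldNormedType.Exports.

Local Open Scope classical_set_scope.
Local Open Scope ring_scope.

(** Write [F] for [Fint f] and [L] for the operator. The function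
    [F (u x) - lambda * psi x] is a supersolution: since [F' = 1/f] and [F'' = - f'/f^2], one has
<<
      L (F u) = F'(u) L u - F''(u) a(grad u, grad u)
              = lambda + f'(u) / f(u)^2 * a(grad u, grad u)
              >= lambda = L (lambda psi),
>>
    because [f' >= 0] and [a] is nonnegative. It vanishes on the boundary, so
    the weak minimum principle ([weak_minimum_principle]) gives
    [lambda * psi <= F (u)] in [Omega] ([torsion_le_Fint]). Everything else is
    the study of the increasing function [F].

    The minimum principle is proved on lines. A uniformly elliptic matrix is a
    Gram matrix [a x = B^T B] ([posdef_gram]), so at the point [x]
    the operator is [D_c - \sum_k D_(b_k) D_(b_k)], with [b_k] the rows of [B]
    ([elliptic_op_lines]). Only the first two derivatives along the lines
    through [x] matter; a [line_jet] records them. These jets compose with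
    functions of one variable, and at an interior minimum the one-dimensional
    second derivative test applies to each of them. The strict inequality that
    the argument needs comes from the barrier [K - expR (gam * x_i)], with [gam]
    large. [F] is differentiable only inside the interval from 0 to [af], so one
    first needs [u > 0] in [Omega]; that, and [psi > 0], follow from the
    same test, as [L u] and [L psi] are positive.

    [F] is strictly increasing and [1 / f 0]-Lipschitz, hence [F^-1] makes sense
    on all values between 0 and [F t] and is bounded by [t] there ([Finv_le]).
    For the extremal solution one passes to the limit in
    [lambda * psi x <= F (v lambda x)] ([Fint_left_limit]): if the limit is below
    [af] the Lipschitz bound controls [F (v lambda x)], and if it is [af] the
    monotonicity of [F] does. *)

(** * Gram matrices *)

(** Cholesky factorization: split off the first coordinate; the Schur complement
    [D - r^T r / al] of the diagonal entry [al] is again positive definite. *)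
Lemma posdef_gram {R : rcfType} n (A : 'M[R]_n) :
  A^T = A -> (forall v : 'rV_n, v != 0 -> 0 < (v *m A *m v^T) 0 0) ->
  exists B : 'M[R]_n, B^T *m B = A.
Proof.
elim: n A => [|n IH]; first by exists 0; apply/matrixP => -[].
rewrite -[n.+1]/(1 + n)%N => A Asym Apos.
pose r := ursubmx A; pose D := drsubmx A.
have [al alE] : exists al, ulsubmx A = al%:M.
  by exists (ulsubmx A 0 0); rewrite -mx11_scalar.
have dlE : dlsubmx A = r^T by rewrite /r trmx_ursub Asym.
have DT : D^T = D by rewrite /D trmx_drsub Asym.
have AE : A = block_mx al%:M r r^T D by rewrite -alE -dlE submxK.
have al_gt0 : 0 < al.
  have := Apos (row_mx (1%:M : 'rV_1) (0 : 'rV_n)).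
  rewrite AE tr_row_mx mul_row_block mul_row_col !mul0mx !addr0 mul1mx.
  rewrite trmx0 mulmx0 addr0 trmx1 mulmx1 mxE eqxx mulr1n; apply.
  apply/eqP => /matrixP/(_ 0 (lshift n 0)); rewrite row_mxEl !mxE eqxx => /eqP.
  by rewrite oner_eq0.
have [|w w0|B' B'E] := IH (D - al^-1 *: (r^T *m r)).
- by rewrite linearB linearZ /= trmx_mul trmxK DT.
(* The vector below extends [w] so as to minimize the form in the first
   coordinate; on it the form of [A] is the form of the Schur complement. *)
- have w'0 : row_mx (- (al^-1 *: (w *m r^T))) w != 0.
    apply: contra_neq w0 => /matrixP w0; apply/matrixP => i j.
    by have := w0 i (rshift 1 j); rewrite row_mxEr !mxE.
  move: (Apos _ w'0); rewrite AE tr_row_mx mul_row_block mul_row_col.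
  rewrite !mulNmx mul_mx_scalar scalerA divff ?gt_eqF// scale1r addNr mul0mx.
  rewrite add0r mulmxDl mulmxBr mulmxBl addrC.
  by rewrite -!scalemxAl -scalemxAr -scalemxAl mulNmx -!scalemxAl !mulmxA.
exists (block_mx (Num.sqrt al)%:M ((Num.sqrt al)^-1 *: r) 0 B' : 'M[R]_(1 + n)).
have sal : Num.sqrt al * Num.sqrt al = al by rewrite -expr2 sqr_sqrtr // ltW.
have sal0 : Num.sqrt al != 0 by rewrite gt_eqF // sqrtr_gt0.
rewrite (@tr_block_mx _ 1 n 1 n) (@mulmx_block _ 1 n 1 n 1 n) AE.
rewrite tr_scalar_mx trmx0 !mul0mx !mulmx0 !addr0 B'E.
rewrite -scalar_mxM sal !linearZ /= mul_scalar_mx mul_mx_scalar !scalerA.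
rewrite mulVf // divff // !scale1r -scalemxAl scalerA -invfM sal.
by rewrite scalerN addrCA subrr addr0.
Qed.

(** * Directional derivatives *)

Section lines.
Context {R : realType} {V : normedModType R}.
Implicit Types (g : V -> R) (U : set V) (x v : V).

Lemma growth_lineE g x v (t : R) :
  (fun h : R => h^-1 *: (((fun s : R => g (x + s *: v)) \o shift t) (h *: 1) -
     g (x + t *: v))) =
  (fun h => h^-1 *: ((g \o shift (x + t *: v)) (h *: v) - g (x + t *: v))).
Proof.
by apply/funext => h /=; rewrite scalerDl addrCA [h *: 1]mulr1 addrA.
Qed.

Lemma is_derive_line g x v (t : R) : derivable g (x + t *: v) v ->
  is_derive t (1 : R) (fun s => g (x + s *: v)) ('D_v g (x + t *: v)).
Proof.
move=> dg; apply: DeriveDef; last by rewrite /derive growth_lineE.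
by rewrite /derivable growth_lineE.
Qed.

Lemma derive_dirZ g x v (k : R) : derivable g x v ->
  'D_(k *: v) g x = k * 'D_v g x.
Proof.
have [->|k0] := eqVneq k 0; first by rewrite scale0r derive0 mul0r.
move=> dg; have dl : is_derive (k * 0) 1 (fun s => g (x + s *: v)) ('D_v g x).
  have -> : 'D_v g x = 'D_v g (x + (k * 0) *: v).
    by rewrite mulr0 scale0r addr0.
  by apply: is_derive_line; rewrite mulr0 scale0r addr0.
have dk : is_derive (0 : R) 1 ( *%R k) k.
  by apply: is_derive_eq (mulr1 k).
have dE := @derive_val _ _ _ _ _ _ _ (@is_derive1_comp _ _ _ _ _ _ dl dk).
rewrite mulrC -dE /derive.
rewrite [X in lim (X @ _)](_ : _ = (fun h : R =>
  h^-1 *: (((fun s => g (x + s *: v)) \o *%R k \o shift 0) (h *: 1)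
    - ((fun s => g (x + s *: v)) \o *%R k) 0))) //.
apply/funext => h /=.
by rewrite [h *: 1]mulr1 addr0 mulr0 scale0r addr0 scalerA [h * k]mulrC [x + _]addrC.
Qed.

(** Continuity of the directional derivatives gives additivity in the direction
    through the mean value theorem: the increment along [v + w] is an increment
    along [v] followed by one along [w] from the shifted point, and the latter
    is a multiple of a value of ['D_w g] near [x]. *)
Lemma derive_dirD g U x v w : open U -> U x ->
  Ck_on 1 U g -> 'D_(v + w) g x = 'D_v g x + 'D_w g x.
Proof.
move=> oU Ux [_ dg]; apply/cvg_lim => //.
have [dv _] := dg v; have [_ [cw _]] := dg w.
pose q1 (h : R) := h^-1 * (g (h *: w + (h *: v + x)) - g (h *: v + x)).
pose q2 (h : R) := h^-1 * (g (h *: v + x) - g x).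
have -> : (fun h => h^-1 *: ((g \o shift x) (h *: (v + w)) - g x)) =
   (fun h => q2 h + q1 h).
  apply/funext => h; rewrite /q1 /q2 /= -mulrDr [_ *: (_ - _)]/(_ * _); congr (_ * _).
  by rewrite scalerDr [h *: v + h *: w]addrC -addrA; ring.
apply: cvgD; first exact: dv.
apply/cvgrPdist_lt => e e0.
have Ucw : nbhs x (U `&` [set y | `|'D_w g x - 'D_w g y| < e]).
  apply: filterI; first exact: open_nbhs_nbhs.
  by have /cvgrPdist_lt/(_ _ e0) := cw x Ux.
have [d /= d0 dU] := (nbhs_ballP _ _).1 Ucw.
pose M := `|v| + `|w| + 1.
have M0 : 0 < M by rewrite /M ltr_wpDl // addr_ge0.
have hM : \forall h \near (0 : R)^', `|h| * M < d.
  near=> h; rewrite -ltr_pdivlMr //.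
  by near: h; apply: dnbhs0_lt; rewrite divr_gt0.
near=> h.
have h0 : h != 0 by near: h; exact: nbhs_dnbhs_neq.
have hd : `|h| * M < d by near: h.
pose y t := (h *: v + x) + t *: (h *: w).
have inU (t : R) : 0 <= t <= 1 -> ball x d (y t).
  move=> /andP[t0 t1]; rewrite -ball_normE /= /y.
  rewrite (_ : x - _ = - (h *: v + t *: (h *: w))); last first.
    by rewrite [h *: v + x + _]addrAC opprD addrCA subrr addr0.
  rewrite normrN (le_lt_trans _ hd) // (le_trans (ler_normD _ _)) //.
  rewrite !normrZ (ger0_norm t0) /M mulrDr mulr1 mulrDr.
  have := normr_ge0 h; have := ler_wpM2r (normr_ge0 (h *: w)) t1.
  rewrite normrZ; lra.
have dl (t : R) : 0 <= t <= 1 -> is_derive t 1 (fun s => g (y s)) (h * 'D_w g (y t)).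
  move=> /inU/dU[Uy _]; rewrite -derive_dirZ; last exact: (dg w).1.
  by apply: is_derive_line; exact: (dg (h *: w)).1.
have [||t tI] := @MVT _ (fun s => g (y s)) (fun t => h * 'D_w g (y t)) 0 1 ltr01.
- by move=> t; rewrite in_itv /= => /andP[t0 t1]; apply: dl; rewrite !ltW.
- by apply: derivable_within_continuous => t; rewrite in_itv /= => /dl [].
rewrite subr0 mulr1 /y scale1r scale0r addr0 => MVTE.
rewrite /q1 [h *: w + _]addrC MVTE mulKf //.
by apply: (dU _ (inU t _)).2; move: tI; rewrite in_itv /= => /andP[/ltW -> /ltW ->].
Unshelve. all: by end_near. Qed.

End lines.

Lemma derive_dir_partial {R : realType} {N} (U : set 'rV[R]_N) g x v :
  open U -> U x -> Ck_on 1 U g ->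
  'D_v g x = \sum_(i < N) v 0 i * partial i g x.
Proof.
move=> oU Ux gC1; have [_ dg] := gC1.
rewrite {1}(row_sum_delta v) (big_morph (fun v => 'D_v g x)
  (fun v w => derive_dirD v w oU Ux gC1) (derive0 g x)).
by apply: eq_bigr => i _; rewrite derive_dirZ //; apply: (dg _).1.
Qed.

Lemma derive2_dir_partial {R : realType} {N} (U : set 'rV[R]_N) g x v :
  open U -> U x -> Ck_on 2 U g ->
  'D_v ('D_v g) x =
  \sum_(i < N) \sum_(j < N) v 0 i * v 0 j * partial i (partial j g) x.
Proof.
move=> oU Ux [cg dg].
have gC1 : Ck_on 1 U g.
  by split=> // w; split; [exact: (dg w).1 | split => //; exact: (dg w).2.1].
have dj (j : 'I_N) : derivable (partial j g) x v by apply: ((dg _).2.2 v).1.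
have -> : 'D_v ('D_v g) x = 'D_v (\sum_(j < N) (v 0 j *: partial j g)) x.
  apply: near_eq_derive; near=> y.
  rewrite (derive_dir_partial _ oU _ gC1) ?fct_sumE //.
  by near: y; exact: open_nbhs_nbhs.
rewrite derive_sum; last by move=> j; exact: derivableZ.
rewrite exchange_big /=; apply: eq_bigr => j _.
rewrite deriveZ // (derive_dir_partial _ oU Ux (dg _).2).
rewrite scaler_sumr; apply: eq_bigr => i _.
by rewrite [_ *: _]mulrA [v 0 j * _]mulrC.
Unshelve. all: by end_near. Qed.

(** The Gram factorization removes the mixed derivatives: the second order part
    is a sum of second derivatives along the rows of [B]. *)
Lemma elliptic_op_lines {R : realType} {N} (U : set 'rV[R]_N) a c g x
    (B : 'M[R]_N) :
  open U -> U x -> Ck_on 2 U g -> B^T *m B = a x ->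
  elliptic_op a c g x =
  'D_(c x) g x - \sum_k 'D_(row k B) ('D_(row k B) g) x.
Proof.
move=> oU Ux gC2 Ba; have [cg dg] := gC2.
have gC1 : Ck_on 1 U g.
  by split=> // w; split; [exact: (dg w).1 | split => //; exact: (dg w).2.1].
rewrite /elliptic_op (derive_dir_partial _ oU Ux gC1) addrC; congr (_ - _).
under [RHS]eq_bigr => k _ do rewrite (derive2_dir_partial _ oU Ux gC2).
rewrite [RHS]exchange_big /=; apply: eq_bigr => i _.
rewrite [RHS]exchange_big /=; apply: eq_bigr => j _.
rewrite -Ba mxE mulr_suml; apply: eq_bigr => k _.
by rewrite !mxE.
Qed.

(** * Jets along lines *)

(** Only the derivative of [phi1] at 0 itself is assumed. If it were negative,
    [phi1] would be negative on some interval to the right of 0, and by the mean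
    value theorem [phi] would go below [phi 0]. *)
Lemma second_derivative_test {R : realType} (phi phi1 : R -> R) (d : R) :
  (\forall t \near 0, is_derive t (1 : R) phi (phi1 t)) ->
  is_derive 0 (1 : R) phi1 d -> (\forall t \near 0, phi 0 <= phi t) ->
  phi1 0 = 0 /\ 0 <= d.
Proof.
move=> dphi dphi1 mphi.
have [e /= e0 he] := (nbhs_ballP _ _).1 (filterI dphi mphi).
have {}he t : -e < t < e -> is_derive t 1 phi (phi1 t) /\ phi 0 <= phi t.
  by move=> te; apply: he; rewrite -ball_normE /= sub0r normrN ltr_norml.
have phi10 : phi1 0 = 0.
  have [||||d0 d0E] := @derive1_at_min R phi (- e) e 0.
  - by rewrite (le_trans _ (ltW e0)) // oppr_le0 ltW.
  - by move=> t; rewrite in_itv /= => /he [[]].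
  - by rewrite in_itv /= oppr_lt0 e0.
  - by move=> t; rewrite in_itv /= => /he [].
  have h0 : - e < 0 < e by rewrite oppr_lt0 e0.
  by rewrite -[RHS]d0E (@derive_val _ _ _ _ _ _ _ (he 0 h0).1).
split=> //; rewrite leNgt; apply/negP => d_lt0.
have := @ex_derive _ _ _ _ _ _ _ dphi1; rewrite /derivable => /cvgrPdist_lt.
have := @derive_val _ _ _ _ _ _ _ dphi1; rewrite /derive => ->.
have nd0 : 0 < - d by rewrite oppr_gt0.
move=> /(_ _ nd0).
rewrite near_withinE => /nbhs_ballP[r /= r0 hr].
pose s := Num.min (e / 2) (r / 2).
have s0 : 0 < s by rewrite lt_min !divr_gt0.
have se : s < e by rewrite gt_min; apply/orP; left; lra.
have sr : s < r by rewrite gt_min; apply/orP; right; lra.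
have [||t] := @MVT R phi phi1 0 s s0.
- by move=> t; rewrite in_itv /= => /andP[t0 ts]; apply: (he t _).1; lra.
- apply: derivable_within_continuous => t; rewrite in_itv /= => /andP[t0 ts].
  by have [|[]] := he t; first lra.
rewrite in_itv /= => /andP[t0 ts] phiE.
have : phi 0 <= phi s by apply: (he s _).2; lra.
rewrite -subr_ge0 phiE subr0 pmulr_lge0 //; apply/negP; rewrite -ltNge.
have := hr t; rewrite -ball_normE /= sub0r normrN ger0_norm ?ltW //.
move=> /(_ (lt_trans ts sr)); rewrite gt_eqF // => /(_ isT).
rewrite addr0 [t *: 1]mulr1 phi10 subr0 ltr_norml => /andP[+ _].
rewrite opprK => tphi; suff : t^-1 * phi1 t < 0 by rewrite pmulr_rlt0 ?invr_gt0.
by move: tphi; rewrite ltrDl oppr_gt0.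
Qed.

(** [p v] and [q v] are the first and second derivatives at [x] of [w] along the
    line of direction [v]. Keeping [p] and [q] as plain functions of [v] makes sums and
    compositions of jets one-dimensional computations. *)
Definition line_jet {R : realType} {V : normedModType R} (w : V -> R) (x : V)
    (p q : V -> R) : Prop :=
  forall v, exists w1 : R -> R,
    [/\ \forall t \near 0, is_derive t (1 : R) (fun s => w (x + s *: v)) (w1 t),
        w1 0 = p v & is_derive (0 : R) 1 w1 (q v)].

Section line_jet.
Context {R : realType} {V : normedModType R}.
Implicit Types (w g : V -> R) (p q : V -> R) (x v : V).

Lemma near_line (P : set V) x v : nbhs x P ->
  \forall t \near (0 : R), P (x + t *: v).
Proof.
move=> xP; suff: (fun t : R => x + t *: v) @ (0 : R) --> x by move/(_ _ xP).
rewrite -[X in _ --> X]addr0 -[X in _ --> _ + X](scale0r v).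
by apply: cvgD; [exact: cvg_cst | apply: cvgZr_tmp; exact: cvg_id].
Qed.

Lemma line_jet_C2 (U : set V) g x : open U -> U x -> Ck_on 2 U g ->
  line_jet g x (fun v => 'D_v g x) (fun v => 'D_v ('D_v g) x).
Proof.
move=> oU Ux [_ dg] v; have [d1 [_ d2]] := dg v.
exists (fun t => 'D_v g (x + t *: v)); split.
- near=> t; apply: is_derive_line; apply: d1.
  by near: t; apply: near_line; exact: open_nbhs_nbhs.
- by rewrite scale0r addr0.
- have := @is_derive_line _ _ ('D_v g) x v 0; rewrite scale0r addr0; apply.
  exact: (d2 v).1.
Unshelve. all: by end_near. Qed.

Lemma line_jetD w g x p q p' q' : line_jet w x p q -> line_jet g x p' q' ->
  line_jet (fun y => w y + g y) x (fun v => p v + p' v) (fun v => q v + q' v).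
Proof.
move=> wj gj v; have [w1 [dw w10 dw1]] := wj v; have [g1 [dg g10 dg1]] := gj v.
exists (fun t => w1 t + g1 t); split.
- near=> t.
  have dwt : is_derive t (1 : R) (fun s => w (x + s *: v)) (w1 t) by near: t.
  have dgt : is_derive t (1 : R) (fun s => g (x + s *: v)) (g1 t) by near: t.
  exact: is_deriveD dwt dgt.
- by rewrite w10 g10.
- exact: is_deriveD dw1 dg1.
Unshelve. all: by end_near. Qed.

Lemma line_jet_cst (k : R) x : line_jet (fun=> k) x (fun=> 0) (fun=> 0).
Proof.
move=> v; exists (fun=> 0); split => //; last exact: is_derive_cst.
by near=> t; exact: is_derive_cst.
Unshelve. all: by end_near. Qed.

Lemma line_jetZ (k : R) w x p q : line_jet w x p q ->
  line_jet (fun y => k * w y) x (fun v => k * p v) (fun v => k * q v).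
Proof.
move=> wj v; have [w1 [dw w10 dw1]] := wj v.
exists (fun t => k * w1 t); split; [|by rewrite w10|].
  near=> t.
  have dwt : is_derive t (1 : R) (fun s => w (x + s *: v)) (w1 t) by near: t.
  exact: is_deriveZ dwt.
exact: is_deriveZ dw1.
Unshelve. all: by end_near. Qed.

Lemma line_jet_comp (G G1 : R -> R) (G2 : R) w x p q :
  {for x, continuous w} ->
  (\forall s \near w x, is_derive s (1 : R) G (G1 s)) ->
  is_derive (w x) (1 : R) G1 G2 -> line_jet w x p q ->
  line_jet (fun y => G (w y)) x (fun v => G1 (w x) * p v)
    (fun v => G2 * p v ^+ 2 + G1 (w x) * q v).
Proof.
move=> cw dG dG1 wj v; have [w1 [dw w10 dw1]] := wj v.
have dGw : \forall t \near (0 : R),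
    is_derive (w (x + t *: v)) (1 : R) G (G1 (w (x + t *: v))).
  apply: (@near_line (fun y => is_derive (w y) (1 : R) G (G1 (w y)))).
  exact: (cw _ dG).
exists (fun t => G1 (w (x + t *: v)) * w1 t); split.
- near=> t.
  have dwt : is_derive t (1 : R) (fun s => w (x + s *: v)) (w1 t) by near: t.
  have dGt : is_derive (w (x + t *: v)) (1 : R) G (G1 (w (x + t *: v))).
    by near: t.
  exact: is_derive1_comp dGt dwt.
- by rewrite scale0r addr0 w10.
- have dw0 : is_derive (0 : R) (1 : R) (fun s => w (x + s *: v)) (w1 0).
    exact: nbhs_singleton dw.
  have dG10 : is_derive (w (x + (0 : R) *: v)) (1 : R) G1 G2.
    by rewrite scale0r addr0.
  have dM := is_deriveM (is_derive1_comp dG10 dw0) dw1.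
  suff <- : (G1 \o (fun s : R => w (x + s *: v))) 0 *: q v +
    w1 0 *: (G2 * w1 0) = G2 * p v ^+ 2 + G1 (w x) * q v by exact: dM.
  by rewrite /= scale0r addr0 w10 /GRing.scale /=; ring.
Unshelve. all: by end_near. Qed.

Lemma line_jet_min w x p q v : line_jet w x p q ->
  (\forall y \near x, w x <= w y) -> p v = 0 /\ 0 <= q v.
Proof.
move=> /(_ v)[w1 [dw <- dw1]] minw; apply: second_derivative_test dw dw1 _.
by rewrite scale0r addr0; exact: (@near_line (fun y => w x <= w y)).
Qed.

End line_jet.

Lemma line_jet_coord {R : realType} {N} (i : 'I_N) (x : 'rV[R]_N) :
  line_jet (fun y : 'rV[R]_N => y 0 i) x (fun v => v 0 i) (fun=> 0).
Proof.
move=> v; exists (fun=> v 0 i); split => //; last exact: is_derive_cst.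
near=> t.
have -> : (fun s : R => (x + s *: v) 0 i) = (fun s : R => x 0 i + v 0 i * s).
  by apply/funext => s; rewrite !mxE mulrC.
have d1 : is_derive t (1 : R) (fun s : R => v 0 i * s) (v 0 i).
  by apply: is_derive_eq (mulr1 (v 0 i)).
by apply: is_derive_eq (is_deriveD (is_derive_cst (x 0 i) t 1) d1) (add0r _).
Unshelve. all: by end_near. Qed.

(** * The weak minimum principle *)

Lemma compact_closure_bounded {R : realType} {N} (A : set 'rV[R]_N) :
  bounded_set A -> compact (closure A).
Proof.
move=> /ex_strict_bound_gt0[M M0 AM].
apply: bounded_closed_compact; last exact: closed_closure.
exists (M + 1); split; first exact: num_real.
move=> K MK x Ax; have [y [Ay]] := Ax _ (nbhsx_ballx x 1 ltr01).
rewrite -ball_normE /= => xy1; rewrite (le_trans _ (ltW MK)) //.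
rewrite -[x](subrK y) (le_trans (ler_normD _ _)) // addrC.
by rewrite lerD // ltW //; exact: AM.
Qed.

Lemma smooth_upto_bounded {R : realType} {N} (A : set 'rV[R]_N) g :
  compact A -> smooth_upto A g ->
  exists2 M : R, 0 < M & forall x, A x -> `|g x| <= M.
Proof.
move=> cA [U [h [oU AU hU hg]]].
have : bounded_set (h @` A).
  apply: compact_bounded; apply: continuous_compact => //.
  apply: continuous_in_subspaceT => x; rewrite inE => Ax.
  by have [+ _] := hU 0%N; apply; exact: AU.
move=> /ex_strict_bound_gt0[M M0 hM]; exists M => // x Ax.
by rewrite -hg // ltW //; apply: hM; exists x.
Qed.

Lemma sum_gramE {R : realType} {N} (B A : 'M[R]_N) i : B^T *m B = A ->
  \sum_k row k B 0 i ^+ 2 = A i i.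
Proof.
by move=> <-; rewrite mxE; apply: eq_bigr => k _; rewrite !mxE expr2.
Qed.

Lemma elliptic_gram {R : realType} {N} (Omega : set 'rV[R]_N) a c x :
  uniformly_elliptic Omega a c -> Omega x ->
  exists B : 'M[R]_N, B^T *m B = a x.
Proof.
move=> hL Ox; apply: posdef_gram.
  by apply/matrixP => i j; rewrite mxE (coef_a_sym hL).
move=> v v0; have [th th0 /(_ x Ox v)] := ellipticity hL.
have -> : (v *m a x *m v^T) 0 0 =
    \sum_(i < N) \sum_(j < N) a x i j * v 0 i * v 0 j.
  rewrite mxE exchange_big /=; apply: eq_bigr => j _.
  rewrite !mxE mulr_suml; apply: eq_bigr => i _.
  by rewrite [v 0 i * _]mulrC.
apply: lt_le_trans; rewrite mulr_gt0 //.
have [i vi0] : exists i, v 0 i != 0.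
  apply/existsP; apply: contraNT v0 => /existsPn v0.
  by apply/eqP/rowP => i; rewrite mxE; apply/eqP; have := v0 i; rewrite negbK.
rewrite (bigD1 i) //= ltr_wpDr //; first by apply: sumr_ge0 => j _; exact: sqr_ge0.
by rewrite exprn_even_gt0.
Qed.

Lemma elliptic_diag {R : realType} {N} (Omega : set 'rV[R]_N) a c i :
  uniformly_elliptic Omega a c ->
  exists2 th : R, 0 < th & forall x, Omega x -> th <= a x i i.
Proof.
move=> hL; have [th th0 hth] := ellipticity hL; exists th => // x Ox.
have := hth x Ox (delta_mx 0 i).
rewrite (bigD1 i) //= big1 ?addr0; last first.
  by move=> j /negbTE ji; rewrite mxE ji expr0n.
rewrite mxE !eqxx expr1n mulr1 => /le_trans; apply.
rewrite (bigD1 i) //= [X in _ + X]big1 ?addr0; last first.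
  by move=> j /negbTE ji; apply: big1 => k _; rewrite !mxE ji mulr0 mul0r.
rewrite (bigD1 i) //= big1 ?addr0; last first.
  by move=> j /negbTE ji; rewrite !mxE ji mulr0.
by rewrite !mxE !eqxx !mulr1.
Qed.

(** The inequality [L w >= 0] at [x], for the operator with leading coefficients
    [A] and drift [b], read through the form of [L] in [elliptic_op_lines]; it
    applies to compositions such as [F u]. *)
Definition jet_supersolution {R : realType} {N} (A : 'M[R]_N) (b : 'rV[R]_N)
    (w : 'rV[R]_N -> R) (x : 'rV[R]_N) : Prop :=
  exists p q, line_jet w x p q /\
    forall B : 'M[R]_N, B^T *m B = A -> 0 <= p b - \sum_k q (row k B).

Lemma interior_min_elliptic_le0 {R : realType} {N} (Omega : set 'rV[R]_N)
    a c g x : open Omega -> uniformly_elliptic Omega a c -> Ck_on 2 Omega g ->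
  Omega x -> (forall y, Omega y -> g x <= g y) -> elliptic_op a c g x <= 0.
Proof.
move=> oO hL gC2 Ox minx; have [B Ba] := elliptic_gram hL Ox.
rewrite (elliptic_op_lines c oO Ox gC2 Ba).
have minv v : 'D_v g x = 0 /\ 0 <= 'D_v ('D_v g) x.
  apply: (line_jet_min v (line_jet_C2 oO Ox gC2)).
  by near=> y; apply: minx; near: y; exact: open_nbhs_nbhs.
rewrite (minv _).1 sub0r oppr_le0; apply: sumr_ge0 => k _; exact: (minv _).2.
Unshelve. all: by end_near. Qed.

(** If [w] is negative somewhere, the minimum of
    [z = w + eps * (K - expR (gam * x_i))] over the closure is still negative for
    small [eps], hence interior, as the added term is nonnegative. There the jet
    of [z] gives [L z <= 0], whereas
    [L z >= eps * gam * expR (gam * x_i) * (gam * a_ii - c_i) > 0]. *)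
Lemma weak_minimum_principle {R : realType} {N} (Omega : set 'rV[R]_N) a c
    (w : 'rV[R]_N -> R) (i : 'I_N) :
  open Omega -> bounded_set Omega -> uniformly_elliptic Omega a c ->
  {within closure Omega, continuous w} ->
  (forall x, bdry Omega x -> 0 <= w x) ->
  (forall x, Omega x -> jet_supersolution (a x) (c x) w x) ->
  forall x, Omega x -> 0 <= w x.
Proof.
move=> oO bO hL cw w_bd w_sup x1 Ox1; rewrite leNgt; apply/negP => w_lt0.
have cO := compact_closure_bounded bO.
have sO : Omega `<=` closure Omega by exact: subset_closure.
have [th th0 a_ge] := elliptic_diag i hL.
have [M M0 c_le] := smooth_upto_bounded cO (coef_c_smooth hL i).
(* This makes [gam * a_ii >= M + 1 > c_i], by ellipticity. *)
pose gam := (M + 1) / th.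
have gam0 : 0 < gam by rewrite divr_gt0 // addr_gt0.
pose E (x : 'rV[R]_N) := expR (gam * x 0 i).
have cE : continuous E.
  move=> x; apply: (@continuous_comp _ _ _ (fun y : 'rV[R]_N => gam * y 0 i) expR);
    last exact: continuous_expR.
  exact: (cvgMl_tmp (@coord_continuous R 1 N 0 i x)).
have [xm _ Em] := compact_EVT_max (ex_intro _ x1 (sO _ Ox1)) cO
  (continuous_subspaceT cE).
pose K := E xm; have K0 : 0 < K by exact: expR_gt0.
(* The perturbation is at most [eps * K], half of the depth of [w] at [x1]. *)
pose eps := - w x1 / (2 * K).
have eps0 : 0 < eps by rewrite divr_gt0 ?oppr_gt0 // mulr_gt0.
have epsK : eps * K = - w x1 / 2.
  by rewrite /eps; field; rewrite gt_eqF.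
pose z x := w x + (eps * K + (- eps) * E x).
have cz : {within closure Omega, continuous z}.
  have cK : continuous (fun y => eps * K + (- eps) * E y).
    by move=> y; exact: (cvgD (cvg_cst (eps * K)) (cvgMl_tmp (cE y))).
  move=> x; apply: cvgD; first exact: cw.
  have cs : {within closure Omega, continuous (fun y => eps * K + - eps * E y)}.
    exact: continuous_subspaceT.
  exact: cs.
have [x2 /set_mem cx2 zmin] := compact_EVT_min (ex_intro _ x1 (sO _ Ox1)) cO cz.
have Ox2 : Omega x2.
  apply: contrapT => nOx2.
  have := zmin x1 (mem_set (sO _ Ox1)); apply/negP; rewrite -ltNge /z.
  have : 0 < eps * E x1 by rewrite mulr_gt0 // expR_gt0.
  have : eps * E x2 <= eps * K by rewrite ler_pM2l //; exact/Em/mem_set.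
  have := w_bd x2 (conj cx2 nOx2); move: epsK; lra.
have [p [q [wj sup]]] := w_sup x2 Ox2.
have [B Ba] := elliptic_gram hL Ox2.
have Ej : line_jet E x2 (fun v => gam * E x2 * v 0 i)
    (fun v => gam ^+ 2 * E x2 * v 0 i ^+ 2 + gam * E x2 * 0).
  have dexp k (s : R) : is_derive s (1 : R) (fun s => k * expR (gam * s))
      (k * gam * expR (gam * s)).
    have dg : is_derive s (1 : R) (fun s => gam * s) gam.
      by apply: is_derive_eq (mulr1 gam).
    have := is_deriveZ k (is_derive1_comp (is_derive_expR (gam * s)) dg).
    by move/is_derive_eq; apply; rewrite /GRing.scale /=; ring.
  apply: (@line_jet_comp R 'rV[R]_N (fun s => expR (gam * s))
    (fun s => gam * expR (gam * s)) (gam ^+ 2 * E x2) (fun y => y 0 i) x2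
    (fun v => v 0 i) (fun=> 0)).
  - exact: (@coord_continuous _ _ _ 0 i).
  - near=> s; have := dexp 1 s; rewrite mul1r.
    by under [X in is_derive _ _ X _ -> _]eq_fun do rewrite mul1r.
  - exact: line_jet_coord.
have zj := line_jetD wj (line_jetD (line_jet_cst (eps * K) x2)
  (line_jetZ (- eps) Ej)).
have zm v := line_jet_min v zj.
have zmin' : \forall y \near x2, z x2 <= z y.
  by near=> y; apply/zmin/mem_set/sO; near: y; exact: open_nbhs_nbhs.
have [pc _] := zm (c x2) zmin'.
have : 0 <= \sum_k (q (row k B) +
    - eps * (gam ^+ 2 * E x2 * row k B 0 i ^+ 2)).
  apply: sumr_ge0 => k _; have [_] := zm (row k B) zmin'.
  by rewrite mulr0 add0r addr0.
have {sup} := sup B Ba.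
rewrite big_split /= -!mulr_sumr (sum_gramE i Ba).
move: pc; set Q := \sum_k _; set P := p _; rewrite add0r => pc QP.
have c2 : c x2 0 i <= M.
  by have := c_le x2 cx2; rewrite ler_norml => /andP[].
apply/negP; rewrite -ltNge.
have E0 : 0 < E x2 := expR_gt0 _.
have e0 : 0 < eps * E x2 * gam by rewrite (mulr_gt0 (mulr_gt0 eps0 E0)).
have gth : gam * th = M + 1 by rewrite /gam divfK // gt_eqF.
have ga : M + 1 <= gam * a x2 i i by rewrite -gth ler_pM2l // a_ge.
have : eps * E x2 * gam * c x2 0 i < eps * E x2 * gam * (gam * a x2 i i).
  by rewrite ltr_pM2l //; lra.
move: pc QP; lra.
Unshelve. all: by end_near. Qed.

(** * The integral of 1/f *)

(** The range of integration of [Fint f t - Fint f s], with [t] possibly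
    infinite. *)
Definition band {R : realType} (s : R) (t : \bar R) : set R :=
  [set y : R | (s%:E <= y%:E < t)%E].

Lemma band_itv {R : realType} (s r : R) : band s r%:E = `[s, r[%classic.
Proof. by apply/seteqP; split=> y; rewrite /band /= in_itv /= lee_fin lte_fin. Qed.

Lemma measurable_band {R : realType} (s : R) t : measurable (band s t).
Proof.
case: t => [r||].
- by rewrite band_itv.
- suff -> : band s +oo%E = `[s, +oo[%classic by [].
  by apply/seteqP; split=> y; rewrite /band /= in_itv /= lee_fin ltry.
- suff -> : band s -oo%E = set0 by [].
  by apply/seteqP; split=> y //; rewrite /band /= andbF.
Qed.

Section Fint.
Context {R : realType} {af : \bar R} {f : R -> R}.
Context (hf : nonlinearity af f).
Local Notation mu := (@lebesgue_measure R).
Local Notation G := (fun s : R => Fint f s%:E).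

Let halfopen_band t : halfopen t = band (0 : R) t. Proof. by []. Qed.

Lemma halfopen0 s : halfopen af s -> halfopen af 0.
Proof. by move=> /andP[s0 saf]; rewrite /halfopen /= lexx (le_lt_trans s0). Qed.

Lemma nonlinearity_ge_f0 s : halfopen af s -> f 0 <= f s.
Proof.
move=> As; apply: (nl_incr hf) => //; first exact: halfopen0 As.
by case/andP: As; rewrite lee_fin.
Qed.

Lemma nonlinearity_gt0 s : halfopen af s -> 0 < f s.
Proof. by move=> /nonlinearity_ge_f0; apply: lt_le_trans; exact: nl_pos0 hf. Qed.

Lemma integrable_recip : mu.-integrable (halfopen af) (EFin \o (fun s => (f s)^-1)).
Proof.
have mA : measurable (halfopen af) by rewrite halfopen_band; exact: measurable_band.
apply/integrableP; split.
  apply/measurable_EFinP.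
  have [U [h [oU AU hU hE]]] := nl_smooth hf.
  apply: (eq_measurable_fun (fun s => (h s)^-1)).
    by move=> s; rewrite inE => As; rewrite hE.
  apply: subspace_continuous_measurable_fun => //.
  apply: continuous_in_subspaceT => s; rewrite inE => As.
  apply: cvgV; first by rewrite hE // gt_eqF // nonlinearity_gt0.
  by have [+ _] := hU 0%N; apply; exact: AU.
apply: le_lt_trans (nl_integral hf); rewrite le_eqVlt; apply/predU1P; left.
apply: eq_integral => s; rewrite inE => As /=; rewrite ger0_norm // invr_ge0 ltW //.
exact: nonlinearity_gt0.
Qed.

Lemma band_sub s t : 0 <= s -> (t <= af)%E -> band s t `<=` halfopen af.
Proof.
move=> s0 taf y /= /andP[sy yt]; apply/andP; split; last exact: lt_le_trans taf.
by rewrite (le_trans _ sy) // lee_fin.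
Qed.

Lemma integrable_band s t : 0 <= s -> (t <= af)%E ->
  mu.-integrable (band s t) (EFin \o (fun s => (f s)^-1)).
Proof.
move=> s0 taf; apply: integrableS integrable_recip.
- exact: (@measurable_band _ 0 af).
- exact: measurable_band.
- exact: band_sub.
Qed.

Lemma Fint_split (s : R) t : 0 <= s -> (s%:E <= t <= af)%E ->
  Fint f t = G s + \int[mu]_(y in band s t) (f y)^-1.
Proof.
move=> s0 /andP[st taf]; rewrite /Fint.
have -> : halfopen t = halfopen s%:E `|` band s t.
  apply/seteqP; split => y; rewrite /halfopen /band /=.
    move=> /andP[y0 yt]; case: (ltP y s) => ys; [left|right].
      by rewrite y0 lte_fin.
    by rewrite lee_fin ys.
  case=> /andP[y0 yt]; first by rewrite y0 (lt_le_trans yt).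
  by rewrite yt (le_trans _ y0) // lee_fin.
rewrite Rintegral_setU //.
- exact: (@measurable_band _ 0 s%:E).
- exact: measurable_band.
- apply: integrableS integrable_recip.
  + exact: (@measurable_band _ 0 af).
  + by apply: measurableU; [exact: (@measurable_band _ 0 s%:E)|exact: measurable_band].
  + move=> y [/andP[y0 yt]|]; last exact: band_sub.
    by rewrite /halfopen /= y0 (lt_le_trans yt) // (le_trans st).
- apply/disj_setPS => y [/andP[_ ys] /andP[sy _]].
  by move: ys; rewrite ltNge sy.
Qed.

Lemma le_Fint s t : (0 <= s)%E -> (s <= t <= af)%E -> Fint f s <= Fint f t.
Proof.
case: s => [s||] s0 /andP[st taf]; last by [].
- rewrite (@Fint_split s t) ?st // lerDl; apply: Rintegral_ge0 => y /(band_sub s0 taf) yA.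
  by rewrite invr_ge0 ltW // nonlinearity_gt0.
- by move: st; rewrite leye_eq => /eqP ->.
Qed.

Lemma integral_band_cst (s t k : R) : s <= t ->
  mu.-integrable (band s t%:E) (EFin \o (fun=> k)) /\
  \int[mu]_(y in band s t%:E) k = (t - s) * k.
Proof.
move=> st; split.
  apply: (@integrableS _ _ _ mu `[s, t]%classic) => //; first exact: measurable_band.
    by rewrite band_itv; apply: subset_itvl; rewrite bnd_simp.
  apply: continuous_compact_integrable; first exact: segment_compact.
  by apply: continuous_subspaceT => x; exact: cvg_cst.
rewrite Rintegral_cst; last exact: measurable_band.
transitivity (k * fine (if s%:E < t%:E then t%:E - s%:E else 0)%E).
  by congr (k * fine _); rewrite band_itv; exact: (lebesgue_measure_itv `[s, t[).
rewrite lte_fin; case: ltP => [|ts]; first by rewrite mulrC.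
by rewrite (_ : t = s) ?subrr ?mulr0 ?mul0r //; apply/eqP; rewrite eq_le ts.
Qed.

Lemma Fint_lipschitz s t : 0 <= s <= t -> (t%:E <= af)%E ->
  G t - G s <= (t - s) / f 0.
Proof.
move=> /andP[s0 st] taf.
rewrite (@Fint_split s t%:E) ?lee_fin ?st // addrAC subrr add0r.
have [ik <-] := integral_band_cst (f 0)^-1 st.
apply: le_Rintegral => //.
- exact: measurable_band.
- exact: integrable_band.
- move=> y /(band_sub s0 taf) yA.
  rewrite lef_pV2 ?posrE ?nonlinearity_ge_f0 ?nonlinearity_gt0 //.
  exact: halfopen0 yA.
Qed.

Lemma Fint_expand s t : 0 <= s <= t -> (t%:E < af)%E ->
  (t - s) / f t <= G t - G s.
Proof.
move=> /andP[s0 st] taf; have taf' := ltW taf.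
rewrite (@Fint_split s t%:E) ?lee_fin ?st // addrAC subrr add0r.
have [ik <-] := integral_band_cst (f t)^-1 st.
have At : halfopen af t by rewrite /halfopen /= lee_fin (le_trans s0).
apply: le_Rintegral => //.
- exact: measurable_band.
- by apply: integrable_band => //; exact: ltW.
- move=> y ybd; have yA := band_sub s0 (ltW taf) ybd.
  rewrite lef_pV2 ?posrE ?nonlinearity_gt0 //.
  by apply: (nl_incr hf) => //; case/andP: ybd => _; rewrite lte_fin => /ltW.
Qed.

Lemma lt_Fint s t : (0 <= s)%E -> (s < t <= af)%E -> Fint f s < Fint f t.
Proof.
case: s => [s||] s0 /andP[st taf] //; last by move: st; rewrite ltNge leey.
have [r sr rt] : exists2 r : R, s < r & (r%:E < t)%E.
  case: t st {taf} => [t||] //; rewrite ?lte_fin => st.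
    by exists ((s + t) / 2); rewrite ?lte_fin; lra.
  by exists (s + 1); rewrite ?ltry //; lra.
rewrite lee_fin in s0; have r0 : 0 <= r by lra.
have raf : (r%:E < af)%E by exact: lt_le_trans taf.
have rF : Fint f r%:E <= Fint f t by apply: le_Fint; rewrite ?lee_fin // (ltW rt).
have sr' : 0 <= s <= r by rewrite s0 ltW.
apply: lt_le_trans rF; rewrite -subr_gt0 (lt_le_trans _ (Fint_expand sr' raf)) //.
rewrite divr_gt0 ?subr_gt0 //; apply: nonlinearity_gt0.
by rewrite /halfopen /= lee_fin r0.
Qed.

Lemma Fint0 : Fint f 0 = 0.
Proof.
rewrite /Fint (_ : halfopen _ = set0) ?Rintegral_set0 //.
by apply/seteqP; split=> y //= /andP[y0]; rewrite ltNge y0.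
Qed.

Lemma Fint_inj : {in Fdom af &, injective (Fint f)}.
Proof.
move=> s t; rewrite !inE => /andP[s0 sa] /andP[t0 ta] st.
case: (ltgtP s t) => // [lt|lt].
- by have := @lt_Fint s t s0; rewrite lt ta st ltxx => /(_ isT).
- by have := @lt_Fint t s t0; rewrite lt sa st ltxx => /(_ isT).
Qed.

Lemma Fint_dist s t : 0 <= s -> 0 <= t -> (s%:E <= af)%E -> (t%:E <= af)%E ->
  `|G s - G t| <= `|s - t| / f 0.
Proof.
wlog st : s t / s <= t => [hw s0 t0 sa ta|s0 t0 sa ta].
  by case/orP: (le_total s t) => st; [|rewrite distrC [`|s - t|]distrC]; apply: hw.
rewrite distrC [`|s - t|]distrC (ger0_norm (_ : 0 <= t - s)) ?subr_ge0 //.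
rewrite ger0_norm; first by apply: Fint_lipschitz; rewrite ?s0.
by rewrite subr_ge0 le_Fint ?lee_fin // st.
Qed.

(** [F] is Lipschitz up to the end [af] when that is finite, and down to 0, which
    [u] attains on the boundary. *)
Lemma Fint_comp_within {T : topologicalType} (A : set T) (u : T -> R) :
  halfopen af 0 -> {within A, continuous u} ->
  (forall x, A x -> 0 <= u x /\ ((u x)%:E <= af)%E) ->
  {within A, continuous (fun x => G (u x))}.
Proof.
move=> A0 /subspace_continuousP cu uA.
apply/subspace_continuousP => x Ax; apply/cvgrPdist_lt => e e0.
have f0 := nonlinearity_gt0 A0.
have := cu x Ax; move=> /cvgrPdist_lt /(_ (e * f 0)) ux.
have uxe : \forall y \near within A (nbhs x), `|u x - u y| < e * f 0.
  by apply: ux; rewrite mulr_gt0.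
near=> y.
have Ay : A y by near: y; exact: withinT.
have [[ux0 uxa] [uy0 uya]] := (uA x Ax, uA y Ay).
rewrite (le_lt_trans (Fint_dist _ _ _ _)) // ltr_pdivrMr //.
by near: y.
Unshelve. all: by end_near. Qed.

Lemma Fint_surj_real (t y : R) : 0 <= t -> (t%:E <= af)%E -> 0 <= y <= G t ->
  exists2 s, 0 <= s <= t & G s = y.
Proof.
move=> t0 taf /andP[y0 yt].
have [A0|nA0] := pselect (halfopen af 0); last first.
  have tE : t = 0.
    apply/eqP; rewrite eq_le t0 andbT leNgt; apply/negP => tp; apply: nA0.
    by rewrite /halfopen /= lexx (lt_le_trans _ taf) // lte_fin.
  exists 0; first by rewrite lexx t0.
  by move: yt; rewrite tE Fint0 => y_le; apply/eqP; rewrite eq_le y0 y_le.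
have cG : {within `[0, t], continuous G}.
  apply: (@Fint_comp_within R `[0, t]%classic id) => //.
    by apply: continuous_subspaceT => x; exact: cvg_id.
  move=> x; rewrite /= in_itv /= => /andP[x0 xt]; split=> //.
  by rewrite (le_trans _ taf) // lee_fin.
have [|s] := @IVT _ G 0 t y t0 cG.
  by rewrite Fint0 ge_min y0 le_max yt orbT.
by rewrite in_itv /= => sI sE; exists s.
Qed.

(** Monotone convergence: without it a value just below [F (+oo)] could fail to
    be a value of [F]. *)
Lemma Fint_pinfty (y : R) : af = +oo%E -> y < Fint f +oo%E ->
  exists2 t, 0 <= t & y < G t.
Proof.
move=> afE yF; apply: contrapT => nex.
have GE t : (0 <= t <= af)%E ->
    (\int[mu]_(x in halfopen t) ((f x)^-1)%:E)%E = (Fint f t)%:E.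
  move=> /andP[t0 ta]; rewrite /Fint fineK //.
  apply: integrable_fin_num; first exact: (@measurable_band _ 0 t).
  exact: (@integrable_band 0 t).
pose F (n : nat) : set R := halfopen n%:R%:E.
have FU : \bigcup_n F n = halfopen +oo%E.
  apply/seteqP; split => x /=.
    by move=> [n _ /andP[x0 _]]; rewrite /halfopen /= x0 ltry.
  move=> /andP[x0 _]; exists (Num.bound x) => //.
  rewrite /F /halfopen /= x0 lte_fin /=.
  by apply: archi_boundP; rewrite -lee_fin.
have mF n : measurable (F n) by exact: (@measurable_band _ 0 n%:R%:E).
have iF n : mu.-integrable (F n) (EFin \o (fun s => (f s)^-1)).
  by apply: (@integrable_band 0); rewrite // afE leey.
have cF : (\int[mu]_(x in F n) ((f x)^-1)%:E)%E @[n --> \oo] -->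
    (\int[mu]_(x in \bigcup_n F n) ((f x)^-1)%:E)%E.
  apply: ge0_nondecreasing_set_cvg_integral => //.
  - move=> n m nm; apply/subsetPset => x; rewrite /F /halfopen /= => /andP[-> xn].
    by rewrite (lt_le_trans xn) // lee_fin ler_nat.
  - by move=> n; have /integrableP[] := iF n.
  - move=> n x /andP[x0 _]; rewrite lee_fin invr_ge0 ltW // nonlinearity_gt0 //.
    by rewrite /halfopen /= x0 afE ltry.
have := lime_le (cvgP _ cF) (x := y%:E).
rewrite (cvg_lim _ cF) // FU GE ?afE ?leey // lee_fin leNgt yF.
move=> hn; suff : false by []; apply: hn; near=> n.
rewrite /F GE ?lee_fin ?afE ?leey ?andbT ?ler0n // leNgt; apply/negP => yn.
by apply: nex; exists n%:R.
Unshelve. all: by end_near. Qed.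

(** By the intermediate value theorem [y] is a value [F s] with [s <= t], and
    [F^-1 y = s] because [F] is injective. *)
Lemma Finv_le t y : Fdom af t -> 0 <= y <= Fint f t ->
  (Fint f @` Fdom af) y /\ (Finv af f y <= t)%E.
Proof.
move=> /andP[t0 ta] /andP[y0 yt].
suff [s /andP[s0 st] <-] : exists2 s, (0 <= s <= t)%E & Fint f s = y.
  have sD : Fdom af s by rewrite /Fdom /= s0 (le_trans st).
  split; first by exists s.
  rewrite /Finv pinvKV //; last exact: mem_set.
  exact: Fint_inj.
case: t t0 ta yt => [t||] // t0 ta yt.
  have yG : 0 <= y <= G t by rewrite y0.
  have [s sI sE] := Fint_surj_real t0 ta yG.
  by exists s%:E.
move: ta; rewrite leye_eq => /eqP afE.
move: yt; rewrite le_eqVlt => /predU1P[->|yt]; first by exists +oo%E; rewrite ?leey.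
have [t t0' yt'] := Fint_pinfty afE yt.
have yG : 0 <= y <= G t by rewrite y0 ltW.
have taf : (t%:E <= af)%E by rewrite afE leey.
have [s /andP[s0 _] sE] := Fint_surj_real t0' taf yG.
by exists s%:E => //; rewrite lee_fin s0 leey.
Qed.


(** * Derivatives of F *)

Lemma near_nonlinearity_domain t : 0 < t -> (t%:E < af)%E ->
  \forall s \near t, 0 < s /\ (s%:E < af)%E.
Proof.
move=> t0 ta.
have [r tr ra] : exists2 r : R, t < r & (r%:E <= af)%E.
  case: {1 2}af ta => [r||] //; first by rewrite lte_fin; exists r.
  by exists (t + 1); rewrite ?leey // ltrDl.
near=> s; split; first by near: s; exact: lt_nbhsr.
rewrite (lt_le_trans _ ra) // lte_fin.
by near: s; exact: lt_nbhsl.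
Unshelve. all: by end_near. Qed.

Lemma nonlinearity_derive t : 0 < t -> (t%:E < af)%E ->
  [/\ {for t, continuous f}, derivable f t 1 & 0 <= 'D_1 f t].
Proof.
move=> t0 ta; have nt := near_nonlinearity_domain t0 ta.
have [U [h [oU AU hU hE]]] := nl_smooth hf.
have At s : 0 < s /\ (s%:E < af)%E -> halfopen af s.
  by move=> [s0 sa]; rewrite /halfopen /= lee_fin ltW.
have hf_near : \forall s \near t, h s = f s by near=> s; apply/hE/At; near: s.
have Ut : U t by apply/AU/At.
have df : derivable f t 1.
  have [_ /(_ 1)[dh _]] := hU 1%N.
  exact: near_eq_derivable hf_near (dh t Ut).
split=> //.
  apply: differentiable_continuous; exact/derivable1_diffP.
have [e /= e0 he] := (nbhs_ballP _ _).1 nt.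
apply: limr_ge => //; near=> s.
have s0 : s != 0 by near: s; exact: nbhs_dnbhs_neq.
have As : halfopen af (s + t).
  apply/At/he; rewrite -ball_normE /= opprD addrCA subrr addr0 normrN.
  by near: s; exact: dnbhs0_lt.
have {}At : halfopen af t by exact: At.
rewrite /= [s *: 1]mulr1 [_ *: _]/(_ * _).
move: s0; rewrite neq_lt => /orP[s0|s0].
  rewrite mulr_le0 // ?invr_le0 ?(ltW s0) // subr_le0 (nl_incr hf) //.
  by rewrite gerDr ltW.
rewrite mulr_ge0 // ?invr_ge0 ?(ltW s0) // subr_ge0 (nl_incr hf) //.
by rewrite lerDr ltW.
Unshelve. all: by end_near. Qed.

Lemma is_derive_Fint t : 0 < t -> (t%:E < af)%E ->
  is_derive t (1 : R) G (f t)^-1.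
Proof.
move=> t0 ta; have [cf _ _] := nonlinearity_derive t0 ta.
have At : halfopen af t by rewrite /halfopen /= lee_fin ltW.
have nt := near_nonlinearity_domain t0 ta.
have [u tu ua] : exists2 u : R, t < u & (u%:E < af)%E.
  have [e /= e0 he] := (nbhs_ballP _ _).1 nt.
  exists (t + e / 2); first by rewrite ltrDl divr_gt0.
  apply: (he _ _).2; rewrite -ball_normE /= opprD addNKr normrN gtr0_norm ?divr_gt0 //.
  by rewrite ltr_pdivrMr // ltr_pMr // ltr1n.
have iu (x : R) : (x%:E < af)%E -> mu.-integrable `[0, x] (EFin \o (fun s => (f s)^-1)).
  move=> xa; apply: integrableS integrable_recip => //.
    exact: (@measurable_band _ 0 af).
  move=> y; rewrite /= in_itv /= /halfopen /= => /andP[y0 yx].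
  by rewrite lee_fin y0 (le_lt_trans _ xa) // lee_fin.
have cfV : {for t, continuous (fun s => (f s)^-1)}.
  by apply: cvgV => //; rewrite gt_eqF // nonlinearity_gt0.
have [dF F'] := continuous_FTC1_closed tu (iu u ua) t0 cfV.
have : is_derive t (1 : R) (fun x => \int[mu]_(t in [set` `[0, x]]) (f t)^-1) (f t)^-1.
  by apply: DeriveDef; [exact: dF | rewrite -derive1E; exact: F'].
apply: near_eq_is_derive; near=> x.
have xa : (x%:E < af)%E by near: x; apply: filterS nt => x [].
rewrite /Fint halfopen_band band_itv Rintegral_itv_bndo_bndc //.
apply: integrableS (iu x xa) => //.
by apply: subset_itvl; rewrite bnd_simp.
Unshelve. all: by end_near. Qed.

Lemma is_derive_recip t : 0 < t -> (t%:E < af)%E ->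
  is_derive t (1 : R) (fun s => (f s)^-1) (- ('D_1 f t / f t ^+ 2)).
Proof.
move=> t0 ta; have [_ df _] := nonlinearity_derive t0 ta.
have At : halfopen af t by rewrite /halfopen /= lee_fin ltW.
have ft0 : f t != 0 by rewrite gt_eqF // nonlinearity_gt0.
apply: DeriveDef; first exact: derivableV.
by rewrite deriveV // scaleNr [_ *: _]mulrC.
Qed.

End Fint.

(** * Comparison with the torsion function *)

(** A zero would be an interior minimum, where [L g <= 0]. *)
Lemma positive_of_elliptic_gt0 {R : realType} {N} (Omega : set 'rV[R]_N) a c g :
  open Omega -> uniformly_elliptic Omega a c -> Ck_on 2 Omega g ->
  (forall x, Omega x -> 0 <= g x) ->
  (forall x, Omega x -> 0 < elliptic_op a c g x) ->
  forall x, Omega x -> 0 < g x.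
Proof.
move=> oO hL gC2 g0 Lg0 x Ox; rewrite lt_neqAle g0 // andbT; apply/negP => /eqP gx.
have := Lg0 x Ox; apply/negP; rewrite -leNgt.
by apply: (interior_min_elliptic_le0 oO hL gC2 Ox) => y Oy; rewrite -gx g0.
Qed.

Lemma torsion_gt0 {R : realType} {N} (Omega : set 'rV[R]_N) a c psi :
  open Omega -> uniformly_elliptic Omega a c -> torsion_function Omega a c psi ->
  forall x, Omega x -> 0 < psi x.
Proof.
move=> oO hL hpsi; apply: (positive_of_elliptic_gt0 oO hL).
- exact: torsion_smooth hpsi 2%N.
- exact: torsion_nonneg hpsi.
- by move=> x Ox; rewrite (torsion_eq hpsi).
Qed.

(** The gradient term [f'(u) / f(u)^2 * a(grad u, grad u)] makes [F u] a
    supersolution of the equation that [lambda * psi] solves. The index [i] is the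
    coordinate of the barrier in the minimum principle. *)
Lemma torsion_le_Fint {R : realType} {N} (Omega : set 'rV[R]_N) a c af f psi
    lambda u (i : 'I_N) :
  open Omega -> bounded_set Omega -> uniformly_elliptic Omega a c ->
  nonlinearity af f -> torsion_function Omega a c psi -> 0 < lambda ->
  solution Omega a c af f lambda u ->
  forall x, Omega x -> lambda * psi x <= Fint f (u x)%:E.
Proof.
move=> oO bO hL hf hpsi l0 hu x0 Ox0.
have fu_gt0 x : Omega x -> 0 < f (u x).
  by move=> Ox; apply: (nonlinearity_gt0 hf); exact: sol_range hu _ Ox.
have A0 := halfopen0 (sol_range hu Ox0).
have u_gt0 : forall x, Omega x -> 0 < u x.
  apply: (positive_of_elliptic_gt0 oO hL (sol_C2 hu)).
  - by move=> x /(sol_range hu)/andP[]; rewrite lee_fin.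
  - by move=> x Ox; rewrite (sol_eq hu) // mulr_gt0 // fu_gt0.
have u_af x : Omega x -> ((u x)%:E < af)%E by move=> /(sol_range hu)/andP[].
have u_bd x : closure Omega x -> ~ Omega x -> u x = 0.
  by move=> cx nx; apply: (sol_bdry hu).
pose w x := Fint f (u x)%:E + (- lambda) * psi x.
suff : 0 <= w x0 by rewrite /w mulNr subr_ge0.
apply: (weak_minimum_principle i oO bO hL) Ox0 => [||x Ox].
- have cF : {within closure Omega, continuous (fun x => Fint f (u x)%:E)}.
    apply: (Fint_comp_within hf A0 (sol_cont hu)) => x cx.
    have [Ox|nOx] := pselect (Omega x); first by rewrite !ltW ?u_gt0 ?u_af.
    by rewrite u_bd // lexx; case/andP: A0 => _ /ltW.
  have cpsi : {within closure Omega, continuous (fun x => - lambda * psi x)}.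
    move=> x; apply: cvgMl_tmp; exact: (torsion_cont hpsi).
  by move=> x; exact: (cvgD (cF x) (cpsi x)).
- move=> x [cx nx]; rewrite /w u_bd // (torsion_bdry hpsi) // mulr0 addr0.
  by rewrite Fint0.
have uC2 := sol_C2 hu; have psiC2 := torsion_smooth hpsi 2%N.
have [cu _] := uC2.
have dF : \forall s \near u x, is_derive s (1 : R) (fun s => Fint f s%:E) (f s)^-1.
  near=> s; suff [s0 sa] : 0 < s /\ (s%:E < af)%E by exact: (is_derive_Fint hf).
  by near: s; exact: (near_nonlinearity_domain (u_gt0 x Ox) (u_af x Ox)).
have jF := line_jet_comp (cu x Ox) dF
  (is_derive_recip hf (u_gt0 x Ox) (u_af x Ox)) (line_jet_C2 oO Ox uC2).
have jpsi := line_jetZ (- lambda) (line_jet_C2 oO Ox psiC2).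
eexists; eexists; split; first exact: line_jetD jF jpsi.
move=> B Ba.
pose Su := \sum_k 'D_(row k B) ('D_(row k B) u) x.
pose Sp := \sum_k 'D_(row k B) ('D_(row k B) psi) x.
pose S2 := \sum_k 'D_(row k B) u x ^+ 2.
have Lu : 'D_(c x) u x - Su = lambda * f (u x).
  by rewrite -(sol_eq hu Ox) (elliptic_op_lines c oO Ox uC2 Ba).
have Lpsi : 'D_(c x) psi x - Sp = 1.
  by rewrite -(torsion_eq hpsi Ox) (elliptic_op_lines c oO Ox psiC2 Ba).
have S20 : 0 <= S2 by apply: sumr_ge0 => k _; exact: sqr_ge0.
have f0 := fu_gt0 x Ox.
have [_ _ f'0] := nonlinearity_derive hf (u_gt0 x Ox) (u_af x Ox).
have sumE (k1 k2 k3 : R) (X Y Z : 'I_N -> R) :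
    \sum_k (k1 * X k ^+ 2 + k2 * Y k + k3 * Z k) =
    k1 * \sum_k X k ^+ 2 + k2 * \sum_k Y k + k3 * \sum_k Z k.
  by rewrite !big_split /= -!mulr_sumr.
have sumq := sumE (- ('D_1 f (u x) / f (u x) ^+ 2)) (f (u x))^-1 (- lambda)
  (fun k => 'D_(row k B) u x) (fun k => 'D_(row k B) ('D_(row k B) u) x)
  (fun k => 'D_(row k B) ('D_(row k B) psi) x).
suff key : 0 <= (f (u x))^-1 * 'D_(c x) u x + - lambda * 'D_(c x) psi x -
  (- ('D_1 f (u x) / f (u x) ^+ 2) * S2 + (f (u x))^-1 * Su + - lambda * Sp).
  by apply: le_trans key _; rewrite lerD2l lerN2 -sumq.
(* What is left of [L (F u) - lambda * L psi] is the gradient term, where [S2]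
   stands for [a(grad u, grad u)]. *)
suff -> : (f (u x))^-1 * 'D_(c x) u x + - lambda * 'D_(c x) psi x -
  (- ('D_1 f (u x) / f (u x) ^+ 2) * S2 + (f (u x))^-1 * Su + - lambda * Sp) =
  ('D_1 f (u x) / f (u x) ^+ 2) * S2.
  by rewrite mulr_ge0 // divr_ge0 // exprn_ge0 // ltW.
have -> : 'D_(c x) u x = lambda * f (u x) + Su by rewrite -Lu subrK.
have -> : 'D_(c x) psi x = 1 + Sp by rewrite -Lpsi subrK.
by field; rewrite gt_eqF.
Unshelve. all: by end_near. Qed.

(** * The extremal solution *)

(** The two cases ask for different bounds before passing to the limit. If
    [T = af], bound [Fint f (g la)] by [Fint f af]. If [T < af], then [g la] is
    eventually below [T + d], where [F] exceeds [F T] by at most [d / f 0]. *)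
Lemma Fint_left_limit {R : realType} (af : \bar R) f (g : R -> R) (l k : R) T :
  nonlinearity af f -> 0 < l ->
  (forall la, 0 < la < l -> halfopen af (g la) /\ la * k <= Fint f (g la)%:E) ->
  (g la)%:E @[la --> l^'-] --> T ->
  Fdom af T /\ l * k <= Fint f T.
Proof.
move=> hf l0 hg gT.
have nl : \forall la \near l^'-, 0 < la < l.
  near=> la; apply/andP; split; near: la; first exact: nbhs_left_gt.
  exact: nbhs_left_lt.
have T0 : (0 <= T)%E.
  rewrite -(cvg_lim _ gT) //; apply: lime_ge; first exact: cvgP gT.
  by near=> la; have [|/andP[]] := hg la; first by near: la.
have Taf : (T <= af)%E.
  rewrite -(cvg_lim _ gT) //; apply: lime_le; first exact: cvgP gT.
  near=> la; have [|/andP[_ /ltW] //] := hg la; by near: la.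
split; first by rewrite /Fdom /= T0.
have ge_limit M : (\forall la \near l^'-, la * k <= M) -> l * k <= M.
  have cl : (fun la : R => la * k) @ l^'- --> l * k.
    apply: cvg_at_left_filter; exact: (cvgMr_tmp (f := id) cvg_id).
  move=> hM; rewrite -(cvg_lim _ cl) //; apply: limr_le => //.
  exact: cvgP cl.
move: Taf; rewrite le_eqVlt => /predU1P[->|Taf].
  apply: ge_limit; near=> la.
  have [|/andP[g0 ga] /le_trans] := hg la; first by near: la.
  by apply; apply: (le_Fint hf); rewrite ?(ltW ga) ?lexx.
case: T T0 Taf gT => [r||] // r0 raf gr; last by move: raf; rewrite ltNge leey.
rewrite lee_fin in r0.
have f0 : 0 < f 0.
  by apply: (nonlinearity_gt0 hf); rewrite /halfopen /= lexx (le_lt_trans _ raf) ?lee_fin.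
have [s rs sa] : exists2 s : R, r < s & (s%:E <= af)%E.
  case: {1 2}af raf => [s||] //; first by rewrite lte_fin; exists s.
  by exists (r + 1); rewrite ?leey // ltrDl.
apply/ler_addgt0Pr => e e0.
pose d := Num.min (s - r) (e * f 0).
have d0 : 0 < d by rewrite lt_min subr_gt0 rs mulr_gt0.
have rda : ((r + d)%:E <= af)%E.
  by rewrite (le_trans _ sa) // lee_fin -lerBrDl ge_min lexx.
apply: ge_limit; near=> la.
have [|/andP[g0 ga] /le_trans] := hg la; first by near: la.
apply; apply: (@le_trans _ _ (Fint f (r + d)%:E)).
  apply: (le_Fint hf) => //; rewrite rda andbT lee_fin ltW //.
  near: la; move/fine_cvgP: gr => [_ gr]; apply: (cvgr_lt r) => //.
  by rewrite ltrDl.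
rewrite -lerBlDl (le_trans (Fint_lipschitz hf _ rda)) ?r0 ?lerDl ?(ltW d0) //.
by rewrite addrAC subrr add0r ler_pdivrMr // ge_min lexx orbT.
Unshelve. all: by end_near. Qed.

Theorem theorem1p3 (R : realType) (N : nat) (hN : (2 <= N)%N)
    (Omega : set 'rV[R]_N) (hOmega : smooth_bounded_domain Omega)
    (a : 'rV[R]_N -> 'M[R]_N) (c : 'rV[R]_N -> 'rV[R]_N)
    (hL : uniformly_elliptic Omega a c)
    (af : \bar R) (f : R -> R)
    (hf : regular_nonlinearity af f \/ singular_nonlinearity af f)
    (psi : 'rV[R]_N -> R) (hpsi : torsion_function Omega a c psi) :
  let psiMax := sup (psi @` Omega) in
  (forall (lambda : R) (u : 'rV[R]_N -> R),
     0 < lambda -> solution Omega a c af f lambda u ->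
     (forall x, Omega x ->
        (Fint f @` Fdom af) (lambda * psi x) /\
        (Finv af f (lambda * psi x) <= (u x)%:E)%E) /\
     (forall x0, Omega x0 -> psi x0 = psiMax ->
        lambda <= Fint f (u x0)%:E / psiMax)) /\
  (forall (lstar : R) (ustar : 'rV[R]_N -> \bar R),
     extremal_parameter Omega a c af f lstar ->
     extremal_solution Omega a c af f lstar ustar ->
     (forall x0, Omega x0 -> psi x0 = psiMax ->
        lstar <= Fint f (ustar x0) / psiMax /\
        Fint f (ustar x0) / psiMax <= Fint f af / psiMax) /\
     (forall x, Omega x ->
        (Fint f @` Fdom af) (lstar * psi x) /\
        (Finv af f (lstar * psi x) <= ustar x)%E)).
Proof.
move=> psiMax.
have oO := domain_open hOmega; have bO := domain_bounded hOmega.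
have nlf : nonlinearity af f by case: hf => -[].
pose i0 : 'I_N := Ordinal (ltnW hN).
have psi_gt0 := torsion_gt0 oO hL hpsi.
have bound lambda u := torsion_le_Fint i0 oO bO hL nlf hpsi (lambda := lambda) (u := u).
have conclude l t x : 0 < l -> Omega x -> Fdom af t -> l * psi x <= Fint f t ->
    (Fint f @` Fdom af) (l * psi x) /\ (Finv af f (l * psi x) <= t)%E.
  move=> l0 Ox Ft lF; apply: Finv_le => //.
  by rewrite lF mulr_ge0 ?(ltW l0) ?(ltW (psi_gt0 _ Ox)).
split=> [lambda u l0 hu|lstar ustar [l0 _ _] [v [hv cv]]].
  split=> x Ox; last first.
    by move=> <-; rewrite ler_pdivlMr ?psi_gt0 //; exact: bound hu _ Ox.
  apply: conclude => //; last exact: bound hu _ Ox.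
  by have /andP[u0 ua] := sol_range hu Ox; rewrite /Fdom /= u0 ltW.
have limit x : Omega x -> Fdom af (ustar x) /\ lstar * psi x <= Fint f (ustar x).
  move=> Ox; apply: Fint_left_limit (cv x Ox) => // la /andP[la0 lal].
  have [[hs _] _] := hv la (introT andP (conj la0 lal)).
  by split; [exact: sol_range hs _ Ox | exact: bound hs _ Ox].
split=> x Ox; have [Fx lx] := limit x Ox; last exact: conclude.
move=> <-; rewrite ler_pdivlMr ?psi_gt0 // lx; split=> //.
rewrite ler_pM2r ?invr_gt0 ?psi_gt0 //.
by case/andP: Fx => u0 ua; apply: (le_Fint nlf); rewrite // ua lexx.
Qed.
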